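(* For problem (P) with $\Phi_\lambda=\Phi_{0,\lambda}$: (i) every stationary point of (P) is a local minimizer of $F$; (ii) if $x^*$ is a local minimizer of $F$ with $F(x^* )<\infty$, and the Slater condition $$\{x:\ x\in\operatorname{ri}(\operatorname{dom}f),\ Ax\in\operatorname{ri}(\operatorname{dom}g),\ (Bx-b)_{\bar J_*}=0\}\neq\emptyset$$ holds, where $J_*=\{i:(Bx^*-b)_i\ne0\}$, $\bar J_*=[r]\setminus J_*$, and ''$\operatorname{ri}$'' may be omitted for $f$ (resp. $g$) when $f$ (resp. $g$) is polyhedral, then $x^*$ is a stationary point of (P).
   Context: Let $f:\mathbb R^n\to(-\infty,\infty]$, $g:\mathbb R^m\to(-\infty,\infty]$ be proper, lsc and convex; $A\in\mathbb R^{m\times n}$, $B\in\mathbb R^{r\times n}$, $b\in\mathbb R^r$, $\lambda\in\mathbb R^r$, $\lambda>0$. $\Phi_{0,\lambda}(u)=\sum_{i=1}^r\lambda_i\mathbf 1_{\{u_i\neq0\}}$; problem (P) is $\min_x F(x)=f(x)+g(Ax)+\Phi_{0,\lambda}(Bx-b)$. $\partial$ denotes the limiting subdifferential (the convex subdifferential for convex functions); $\partial\Phi_{0,\lambda}(u)=\{z: z_i\in\mathbb R\text{ if }u_i=0,\ z_i=0\text{ otherwise}\}$. A point $x^*$ is a stationary point of (P) if $0\in\partial f(x^* )+A^\top\partial g(Ax^* )+B^\top\partial\Phi_{0,\lambda}(Bx^*-b)$. $\operatorname{ri}$ denotes relative interior. *)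

(* Defs.v *)
From HB Require Import structures.
From mathcomp Require Import all_boot all_order all_algebra.
From mathcomp Require Import all_classical all_reals.
Set Implicit Arguments. Unset Strict Implicit. Unset Printing Implicit Defensive.
Import Order.TTheory GRing.Theory Num.Theory.
Local Open Scope ring_scope.

Section Defs.
Context {R : realType}.

Definition dotv {k : nat} (u v : 'cV[R]_k) : R := \sum_i u i 0 * v i 0.
Definition sqdist {k : nat} (u v : 'cV[R]_k) : R := \sum_i (u i 0 - v i 0) ^+ 2.

Definition edom {k : nat} (f : 'cV[R]_k -> \bar R) : set 'cV[R]_k :=
  [set x | (f x < +oo)%E].

Definition proper_fun {k : nat} (f : 'cV[R]_k -> \bar R) : Prop :=
  (forall x, f x != -oo%E) /\ (exists x, (f x < +oo)%E).

(* lower semicontinuity (balls of radius sqrt e) *)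
Definition lsc_fun {k : nat} (f : 'cV[R]_k -> \bar R) : Prop :=
  forall x (a : R), (a%:E < f x)%E ->
    exists2 e : R, 0 < e & forall y, sqdist y x < e -> (a%:E < f y)%E.

Definition convex_fun {k : nat} (f : 'cV[R]_k -> \bar R) : Prop :=
  forall (x y : 'cV[R]_k) (t : R), 0 < t < 1 ->
    (f ((1 - t) *: x + t *: y)%R <= (1 - t)%:E * f x + t%:E * f y)%E.

Definition subdiff {k : nat} (f : 'cV[R]_k -> \bar R) (x : 'cV[R]_k) : set 'cV[R]_k :=
  [set v | f x \is a fin_num /\ forall y, (f x + (dotv v (y - x))%:E <= f y)%E].

(* Phi_{0,lambda} and its (limiting) subdifferential as given in the paper *)
Definition Phi0 {r : nat} (lam u : 'cV[R]_r) : R :=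
  \sum_i lam i 0 * (u i 0 != 0)%:R.
Definition subdiff_Phi0 {r : nat} (u : 'cV[R]_r) : set 'cV[R]_r :=
  [set z | forall i, u i 0 != 0 -> z i 0 = 0].

Definition Fobj {n m r : nat} (f : 'cV[R]_n -> \bar R) (g : 'cV[R]_m -> \bar R)
  (A : 'M[R]_(m, n)) (B : 'M[R]_(r, n)) (b lam : 'cV[R]_r) (x : 'cV[R]_n) : \bar R :=
  (f x + g (A *m x) + (Phi0 lam (B *m x - b))%:E)%E.

Definition stationary {n m r : nat} (f : 'cV[R]_n -> \bar R) (g : 'cV[R]_m -> \bar R)
  (A : 'M[R]_(m, n)) (B : 'M[R]_(r, n)) (b : 'cV[R]_r) (x : 'cV[R]_n) : Prop :=
  exists u w z, subdiff f x u /\ subdiff g (A *m x) w /\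
    subdiff_Phi0 (B *m x - b) z /\ u + A^T *m w + B^T *m z = 0.

Definition local_min {k : nat} (F : 'cV[R]_k -> \bar R) (x : 'cV[R]_k) : Prop :=
  exists2 e : R, 0 < e & forall y, sqdist y x < e -> (F x <= F y)%E.

Definition affine_hull {k : nat} (C : set 'cV[R]_k) : set 'cV[R]_k :=
  [set y | exists (p : nat) (pt : 'I_p -> 'cV[R]_k) (c : 'I_p -> R),
     (forall i, C (pt i)) /\ \sum_i c i = 1 /\ y = \sum_i c i *: pt i].

Definition ri {k : nat} (C : set 'cV[R]_k) : set 'cV[R]_k :=
  [set x | C x /\ exists2 e : R, 0 < e &
     forall y, affine_hull C y -> sqdist y x < e -> C y].

(* polyhedral function: epigraph is an intersection of finitely many closed
   half-spaces of R^k x R *)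
Definition polyhedral_fun {k : nat} (f : 'cV[R]_k -> \bar R) : Prop :=
  exists (p : nat) (M : 'M[R]_(p, k)) (a d : 'cV[R]_p),
    forall x (t : R), (f x <= t%:E)%E <-> (forall i, (M *m x) i 0 + a i 0 * t <= d i 0).

Definition slater {n m r : nat} (f : 'cV[R]_n -> \bar R) (g : 'cV[R]_m -> \bar R)
  (A : 'M[R]_(m, n)) (B : 'M[R]_(r, n)) (b : 'cV[R]_r) (xs : 'cV[R]_n) : Prop :=
  exists x : 'cV[R]_n,
    (ri (edom f) x \/ (polyhedral_fun f /\ edom f x)) /\
    (ri (edom g) (A *m x) \/ (polyhedral_fun g /\ edom g (A *m x))) /\
    (forall i, (B *m xs - b) i 0 = 0 -> (B *m x - b) i 0 = 0).

End Defs.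

(* Main.v *)
(* Near a point x, the components of B x - b that are nonzero stay nonzero and the
   jump lam i dominates any small linear term z i (B y - b) i, so a stationary point
   is a local minimizer.  Conversely a local minimizer x minimizes the convex
   function f + g o A over the affine space where the zero components of B x - b
   remain zero.  The multipliers are obtained on (R^n x R) x (R^m x R) from a Farkas
   lemma for affine inequalities over a convex set C that only asks for a feasible
   point in the relative interior of C: C collects the epigraphs of the functions
   qualified by relative interiors, the inequalities describe the polyhedral
   epigraphs, and y = A x and the equations from B are the equality constraints. *)
Require Import Defs.
From HB Require Import structures.
From mathcomp Require Import all_boot all_order all_algebra.
From mathcomp Require Import all_classical all_reals.
From mathcomp Require Import ring lra.
Import Order.TTheory GRing.Theory Num.Theory.
Local Open Scope ring_scope.

Set Implicit Arguments.
Unset Strict Implicit.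

(** * Farkas lemma for affine constraints over a convex set *)

Section ConvexFarkas.
Context {R : realType} {V : lmodType R}.
Implicit Types (C : set V) (l h : V -> R).

Definition convex_set C : Prop :=
  forall x y (t : R), C x -> C y -> 0 < t < 1 -> C ((1 - t) *: x + t *: y).

Definition affine_fun l : Prop :=
  forall x y (t : R), l ((1 - t) *: x + t *: y) = (1 - t) * l x + t * l y.

(* Algebraic relative interior: every segment of C ending at x extends beyond x.
   The coefficients are written 1 - t and t with t = - e to match affine_fun. *)
Definition core C x : Prop :=
  C x /\ forall y, C y -> exists2 e : R, 0 < e & C ((1 - - e) *: x + (- e) *: y).

(** The point at length [e'] lies between [x] and the point at length [e], with weight [e' / e].
    This lets two extension lengths be replaced by their minimum. *)
Lemma convex_shrink C x y (e e' : R) : convex_set C -> C x -> 0 < e' <= e ->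
  C ((1 - - e) *: x + (- e) *: y) -> C ((1 - - e') *: x + (- e') *: y).
Proof.
move=> cC Cx /andP[e'0 ee'] Ce.
move: ee'; rewrite le_eqVlt => /orP[/eqP -> //|ee'].
have e0 : 0 < e by lra.
have -> : (1 - - e') *: x + - e' *: y =
    (1 - e' / e) *: x + (e' / e) *: ((1 - - e) *: x + (- e) *: y).
  rewrite scalerDr !scalerA addrA -scalerDl mulrN mulfVK ?gt_eqF //.
  congr (_ *: _ + _); rewrite mulrBr mulr1 mulrN mulfVK ?gt_eqF //; ring.
by apply: cC => //; rewrite divr_gt0 //= ltr_pdivrMr // mul1r.
Qed.

Lemma affine_fun_sum (I : finType) (S : {set I}) (mu : I -> R) (l : I -> V -> R) h :
  affine_fun h -> (forall i, affine_fun (l i)) ->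
  affine_fun (fun x => h x + \sum_(i in S) mu i * l i x).
Proof.
move=> ah al x y t; rewrite ah.
rewrite (eq_bigr (fun i => (1 - t) * (mu i * l i x) + t * (mu i * l i y))).
  by rewrite big_split /= -!mulr_sumr; ring.
by move=> i _; rewrite al; ring.
Qed.

Lemma convex_setI_le (I : finType) (S : {set I}) (l : I -> V -> R) C :
  convex_set C -> (forall i, affine_fun (l i)) ->
  convex_set (fun x => C x /\ forall i, i \in S -> l i x <= 0).
Proof.
move=> cC al x y t [Cx lx] [Cy ly] /[dup] t01 /andP[t0 t1]; split; first exact: cC.
by move=> i iS; rewrite al; have := lx i iS; have := ly i iS; nra.
Qed.

Lemma convex_setI_eq l C :
  convex_set C -> affine_fun l -> convex_set (fun x => C x /\ l x = 0).
Proof.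
move=> cC al x y t [Cx lx] [Cy ly] t01; split; first exact: cC.
by rewrite al lx ly !mulr0 addr0.
Qed.

Lemma core_setI_eq l C x :
  affine_fun l -> core C x -> l x = 0 -> core (fun x => C x /\ l x = 0) x.
Proof.
move=> al [Cx rx] lx; split=> // y [Cy ly].
have [e e0 Ce] := rx _ Cy; exists e => //; split=> //.
by rewrite al lx ly !mulr0 addr0.
Qed.

Lemma affine_min_core l C x0 :
  affine_fun l -> core C x0 -> (forall x, C x -> 0 <= l x) -> l x0 <= 0 ->
  forall x, C x -> l x = 0.
Proof.
move=> al [Cx rx] l0 lx0 x Cy; have [e e0 Ce] := rx _ Cy.
have := l0 _ Ce; have := l0 _ Cy; rewrite al => ly le.
by apply/eqP; rewrite eq_le ly andbT; nra.
Qed.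

(** A valid [tau] separates the ratios [- h x / l x] with [l x > 0] from the ratios [h y / - l y]
    with [l y < 0]; the supremum of the former is taken. *)
Lemma multiplier_eq C h l y0 x0 :
  convex_set C -> affine_fun h -> affine_fun l ->
  C y0 -> l y0 < 0 -> C x0 -> 0 < l x0 ->
  (forall x, C x -> l x = 0 -> 0 <= h x) ->
  exists tau : R, forall x, C x -> 0 <= h x + tau * l x.
Proof.
move=> cC ah al Cy0 ly0 Cx0 lx0 h0.
pose E : set R := fun s => exists x, [/\ C x, 0 < l x & s = - h x / l x].
have cross x y : C x -> 0 < l x -> C y -> l y < 0 -> - h x / l x <= h y / - l y.
  move=> Cx lx Cy ly; rewrite ler_pdivrMr // mulrAC ler_pdivlMr ?oppr_gt0 //.
  have d0 : 0 < l x - l y by lra.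
  (* At this [t] the segment from [x] to [y] crosses [l = 0], where [h] is nonnegative. *)
  pose t := l x / (l x - l y).
  have tE : t * (l x - l y) = l x by rewrite /t mulfVK // gt_eqF.
  have t01 : 0 < t < 1.
    by rewrite /t divr_gt0 //= ltr_pdivrMr // mul1r; lra.
  have lz : l ((1 - t) *: x + t *: y) = 0 by rewrite al; lra.
  have := h0 _ (cC _ _ _ Cx Cy t01) lz; rewrite ah => hz.
  have : 0 <= ((1 - t) * h x + t * h y) * (l x - l y) by rewrite mulr_ge0 // ltW.
  have -> : ((1 - t) * h x + t * h y) * (l x - l y) =
    h x * (l x - l y) + t * (l x - l y) * (h y - h x) by ring.
  by rewrite tE; lra.
have Ex0 : E (- h x0 / l x0) by exists x0.
have supE : has_sup E.
  split; first by exists (- h x0 / l x0).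
  by exists (h y0 / - l y0) => s [x [Cx lx ->]]; exact: cross.
exists (sup E) => x Cx; have [lx|lx|lx] := ltgtP (l x) 0.
- have : sup E <= h x / - l x.
    apply: ge_sup; first by exists (- h x0 / l x0).
    by move=> s [z [Cz lz ->]]; exact: cross.
  by rewrite ler_pdivlMr ?oppr_gt0 //; lra.
- have : - h x / l x <= sup E by apply: ub_le_sup; [case: supE|exists x].
  by rewrite ler_pdivrMr //; lra.
- by rewrite lx mulr0 addr0; exact: h0.
Qed.

(** A negative multiplier can be replaced by 0, since it already forces [h >= 0] wherever
    [l > 0]. *)
Lemma multiplier_le C h l y0 :
  convex_set C -> affine_fun h -> affine_fun l -> C y0 -> l y0 < 0 ->
  (forall x, C x -> l x <= 0 -> 0 <= h x) ->
  exists2 tau : R, 0 <= tau & forall x, C x -> 0 <= h x + tau * l x.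
Proof.
move=> cC ah al Cy0 ly0 h0.
have [[x0 Cx0 lx0]|nx0] := pselect (exists2 x0, C x0 & 0 < l x0); last first.
  exists 0 => // x Cx; rewrite mul0r addr0; apply: h0 => //.
  by rewrite leNgt; apply/negP => lx; apply: nx0; exists x.
have [|tau ht] := @multiplier_eq _ h l _ _ cC ah al Cy0 ly0 Cx0 lx0.
  by move=> x Cx lx; apply: h0 => //; rewrite lx.
have [t0|t0] := leP 0 tau; first by exists tau.
exists 0 => // x Cx; have [lx|lx] := leP (l x) 0.
  by rewrite mul0r addr0; exact: h0.
by have := ht _ Cx; nra.
Qed.

(** Unless [l] vanishes on [C], a segment extended beyond [x0] supplies points with both signs of
    [l]. *)
Lemma multiplier_eq_core C h l x0 :
  convex_set C -> affine_fun h -> affine_fun l -> core C x0 -> l x0 = 0 ->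
  (forall x, C x -> l x = 0 -> 0 <= h x) ->
  exists tau : R, forall x, C x -> 0 <= h x + tau * l x.
Proof.
move=> cC ah al rx lx0 h0.
have [[y Cy ly]|ny] := pselect (exists2 y, C y & l y != 0); last first.
  exists 0 => x Cx; rewrite mul0r addr0; apply: h0 => //.
  by apply/eqP; apply/negPn/negP => lx; apply: ny; exists x.
have [e e0 Ce] := (rx.2 _ Cy).
have := al x0 y (- e); rewrite lx0 mulr0 add0r mulNr => le.
move: ly; rewrite neq_lt => /orP[] ly.
  apply: (multiplier_eq cC ah al Cy ly Ce) => //.
  by rewrite le oppr_gt0 pmulr_rlt0.
apply: (multiplier_eq cC ah al Ce _ Cy ly) => //.
by rewrite le oppr_lt0 mulr_gt0.
Qed.

(* Induction on the number of constraints.  Pick a constraint p.  If it can be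
   satisfied strictly together with the others, its multiplier comes from the
   one-constraint case.  Otherwise l p >= 0 on the rest of the feasible set, and
   the induction hypothesis for the objective l p gives a nonnegative combination
   of the constraints vanishing on C; a constraint i0 with positive weight in it
   is then an equality constraint, whose multiplier may have any sign because
   adding multiples of the vanishing combination makes it nonnegative. *)
Lemma convex_farkas (I : finType) (l : I -> V -> R) (S : {set I}) C h x0 :
  (forall i, affine_fun (l i)) -> convex_set C -> affine_fun h ->
  core C x0 -> (forall i, i \in S -> l i x0 <= 0) ->
  (forall x, C x -> (forall i, i \in S -> l i x <= 0) -> 0 <= h x) ->
  exists2 mu : I -> R, (forall i, 0 <= mu i) &
    forall x, C x -> 0 <= h x + \sum_(i in S) mu i * l i x.
Proof.
move=> al; have [k] := ubnP #|S|; elim: k => // k IH in S C h *.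
move=> cS cC ah rx lx0 h0.
have [S0|[p pS]] := set_0Vmem S.
  exists (fun=> 0) => // x Cx; rewrite big1 ?addr0; last by move=> i _; rewrite mul0r.
  by apply: h0 => // i; rewrite S0 inE.
have cSD i : i \in S -> (#|S :\ i| < k)%N.
  by move=> iS; move: cS; rewrite (cardsD1 i S) iS add1n ltnS.
have SD i j : i \in S :\ j -> i \in S by rewrite inE => /andP[].
have lx0D j i : i \in S :\ j -> l i x0 <= 0 by move=> /SD; exact: lx0.
have [[y0 [Cy0 ly0] lp0]|np] :=
  pselect (exists2 y0, C y0 /\ (forall i, i \in S :\ p -> l i y0 <= 0) & l p y0 < 0).
  have [|tau tau0 ht] := @multiplier_le
    (fun x => C x /\ forall i, i \in S :\ p -> l i x <= 0) h (l p) y0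
    (convex_setI_le (S := S :\ p) cC al) ah (al p) (conj Cy0 ly0) lp0.
    move=> x [Cx lx] lpx; apply: h0 => // i iS.
    by have [->//|ip] := eqVneq i p; apply: lx; rewrite !inE ip.
  have ah' : affine_fun (fun x => h x + tau * l p x).
    by move=> x y t; rewrite ah al; ring.
  have [|mu mu0 hmu] := IH (S :\ p) C _ (cSD _ pS) cC ah' rx (lx0D p).
    by move=> x Cx lx; apply: ht.
  exists (fun i => if i == p then tau else mu i); first by move=> i; case: ifP.
  move=> x Cx; rewrite (big_setD1 p) //= eqxx addrA.
  rewrite (eq_bigr (fun i => mu i * l i x)); first exact: hmu.
  by move=> i; rewrite !inE => /andP[/negPf ->].
have [|mu mu0 hmu] := IH (S :\ p) C (l p) (cSD _ pS) cC (al p) rx (lx0D p).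
  move=> x Cx lx; rewrite leNgt; apply/negP => lpx.
  by apply: np; exists x.
pose K x := l p x + \sum_(i in S :\ p) mu i * l i x.
have aK : affine_fun K by exact: affine_fun_sum.
have sumle0 : \sum_(i in S :\ p) mu i * l i x0 <= 0.
  by apply: sumr_le0 => i iS; rewrite mulr_ge0_le0 // (lx0D p).
have Kx0 : K x0 <= 0 by rewrite /K; have := lx0 p pS; lra.
have K0 := @affine_min_core K C x0 aK rx hmu Kx0.
(* Without a positive weight, [K] reduces to [l p], so the constraint [p] is void on [C]. *)
have [[i0 i0S mui0]|nmu] := pselect (exists2 i, i \in S :\ p & 0 < mu i); last first.
  have lp0 x : C x -> l p x = 0.
    move=> Cx; rewrite -(K0 _ Cx) /K big1 ?addr0 // => i iS.
    have := mu0 i; rewrite le_eqVlt => /orP[/eqP <-|mui]; first by rewrite mul0r.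
    by case: nmu; exists i.
  have [|nu nu0 hnu] := IH (S :\ p) C h (cSD _ pS) cC ah rx (lx0D p).
    move=> x Cx lx; apply: h0 => // i iS.
    have [->|ip] := eqVneq i p; first by rewrite lp0.
    by apply: lx; rewrite !inE ip.
  exists nu => // x Cx; rewrite (big_setD1 p) //= lp0 // mulr0 add0r; exact: hnu.
have i0S' : i0 \in S := SD _ _ i0S.
(* [K x0 = 0] is a sum of nonpositive terms, and the weight of [l i0 x0] is positive. *)
have li0 : l i0 x0 = 0.
  have := K0 _ rx.1; rewrite /K (big_setD1 i0) //=.
  have : \sum_(i in (S :\ p) :\ i0) mu i * l i x0 <= 0.
    apply: sumr_le0 => i; rewrite inE => /andP[_ iS].
    by rewrite mulr_ge0_le0 // (lx0D p).
  have := lx0 p pS; have := lx0 _ i0S' => a1 a2 a3 a4.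
  by apply/eqP; rewrite eq_le a1 /= -(pmulr_rge0 _ mui0); lra.
have [|nu nu0 hnu] := IH (S :\ i0) _ h (cSD _ i0S') (convex_setI_eq cC (al i0))
    ah (core_setI_eq (al i0) rx li0) (lx0D i0).
  move=> x [Cx lix] lx; apply: h0 => // i iS.
  have [->|ii] := eqVneq i i0; first by rewrite lix.
  by apply: lx; rewrite !inE ii.
have [|tau ht] := @multiplier_eq_core C _ (l i0) x0 cC
    (affine_fun_sum (S :\ i0) nu ah al) (al i0) rx li0.
  by move=> x Cx lix; apply: hnu.
(* Chosen so that [s * mu i0] is the absolute value of [tau], which compensates a negative [tau]. *)
pose s := `|tau| / mu i0.
have s0 : 0 <= s by rewrite divr_ge0.
(* These are the weights of [K], with 1 at [p]; their combination vanishes on [C]. *)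
pose mu' i := if i == p then 1 else mu i.
have mu'0 i : 0 <= mu' i by rewrite /mu'; case: ifP.
exists (fun i => (if i == i0 then tau else nu i) + s * mu' i).
  move=> i; case: eqVneq => [->|_]; last by rewrite addr_ge0 // mulr_ge0.
  rewrite /mu'; move: i0S; rewrite inE => /andP[]; rewrite inE => /negPf -> _.
  by rewrite /s mulfVK ?gt_eqF //; have := ler_norm (- tau); rewrite normrN; lra.
move=> x Cx.
rewrite (eq_bigr (fun i => (if i == i0 then tau else nu i) * l i x
  + s * (mu' i * l i x))); last by move=> i _; ring.
rewrite big_split /= -mulr_sumr [X in s * X](big_setD1 p) //= {1}/mu' eqxx.
have -> : s * (1 * l p x + \sum_(i in S :\ p) mu' i * l i x) = 0.
  rewrite mul1r (eq_bigr (fun i => mu i * l i x)) => [|i].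
    by rewrite -/(K x) K0 // mulr0.
  by rewrite /mu' !inE => /andP[/negPf ->].
rewrite addr0 (big_setD1 i0) //= eqxx.
rewrite (eq_bigr (fun i => nu i * l i x)).
  by have := ht _ Cx; lra.
by move=> i; rewrite !inE => /andP[/negPf ->].
Qed.

(** Each equality is split into two opposite inequalities; the difference of their multipliers has
    free sign. *)
Lemma convex_farkas_eq (I K : finType) (l : I -> V -> R) (q : K -> V -> R) C h x0 :
  (forall i, affine_fun (l i)) -> (forall k, affine_fun (q k)) ->
  convex_set C -> affine_fun h ->
  core C x0 -> (forall i, l i x0 <= 0) -> (forall k, q k x0 = 0) ->
  (forall x, C x -> (forall i, l i x <= 0) -> (forall k, q k x = 0) -> 0 <= h x) ->
  exists (mu : I -> R) (tau : K -> R), (forall i, 0 <= mu i) /\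
    forall x, C x -> 0 <= h x + \sum_i mu i * l i x + \sum_k tau k * q k x.
Proof.
move=> al aq cC ah rx lx qx h0.
pose L (j : I + (K + K)) x : R :=
  match j with inl i => l i x | inr (inl k) => q k x | inr (inr k) => - q k x end.
have aL j : affine_fun (L j).
  by case: j => [i|[k|k]] x y t /=; rewrite ?al ?aq //; ring.
have [||mu mu0 hmu] := @convex_farkas _ L [set: _] C h x0 aL cC ah rx.
- by case=> [i|[k|k]] _ //=; rewrite qx ?oppr0.
- move=> x Cx Lx; apply: h0 => // [i|k]; first exact: (Lx (inl i) (finset.in_setT _)).
  have := Lx (inr (inl k)) (finset.in_setT _); have := Lx (inr (inr k)) (finset.in_setT _) => /=.
  by move=> a1 a2; apply/eqP; rewrite eq_le a2 /=; lra.
exists (fun i => mu (inl i)), (fun k => mu (inr (inl k)) - mu (inr (inr k))).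
split=> // x Cx; have := hmu x Cx.
rewrite (eq_bigl xpredT) => [|i]; last by rewrite inE.
rewrite !big_sumType /= addrA.
rewrite [X in _ -> 0 <= _ + X](eq_bigr (fun k => mu (inr (inl k)) * q k x
  + mu (inr (inr k)) * - q k x)) => [|k _]; last by ring.
by rewrite big_split /= !addrA.
Qed.

End ConvexFarkas.

(** * Euclidean distance, relative interiors and convex functions *)

Section ConvexAnalysis.
Context {R : realType}.

Lemma dotvE k (u v : 'cV[R]_k) : dotv u v = (u^T *m v) 0 0.
Proof. by rewrite mxE; apply: eq_bigr => i _; rewrite mxE. Qed.

Lemma dotv_trmx m n (A : 'M[R]_(m, n)) w x : dotv (A^T *m w) x = dotv w (A *m x).
Proof. by rewrite !dotvE trmx_mul trmxK mulmxA. Qed.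

Lemma dotvDl k (u v w : 'cV[R]_k) : dotv (u + v) w = dotv u w + dotv v w.
Proof. by rewrite !dotvE raddfD mulmxDl mxE. Qed.

Lemma dotvNl k (u w : 'cV[R]_k) : dotv (- u) w = - dotv u w.
Proof. by rewrite !dotvE raddfN mulNmx mxE. Qed.

Lemma dotvBr k (u v w : 'cV[R]_k) : dotv u (v - w) = dotv u v - dotv u w.
Proof. by rewrite !dotvE mulmxBr !mxE. Qed.

Lemma sqdist_ge0 k (x y : 'cV[R]_k) : 0 <= sqdist x y.
Proof. by apply: sumr_ge0 => i _; exact: sqr_ge0. Qed.

Lemma sqdist_line k (x y : 'cV[R]_k) (t : R) :
  sqdist ((1 - t) *: x + t *: y) x = t ^+ 2 * sqdist y x.
Proof.
rewrite /sqdist mulr_sumr; apply: eq_bigr => i _; rewrite !mxE; ring.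
Qed.

Lemma small_step (D e : R) : 0 <= D -> 0 < e -> exists2 t, 0 < t < 1 & t ^+ 2 * D < e.
Proof.
move=> D0 e0; have p0 : 0 < 1 + e + D by lra.
pose t := e / (1 + e + D).
have tE : t * (1 + e + D) = e by rewrite /t mulfVK // gt_eqF.
have t0 : 0 < t by rewrite /t divr_gt0.
exists t; first by rewrite t0 /t ltr_pdivrMr //; lra.
have tD : t * D < e by nra.
have t1 : t < 1 by rewrite /t ltr_pdivrMr //; lra.
have : 0 <= t * D by rewrite mulr_ge0 // ltW.
by nra.
Qed.

(** A point slightly beyond [x] is an affine combination of [x] and [y], so it lies in the affine
    hull and close to [x]. *)
Lemma ri_core k (C : set 'cV[R]_k) x : ri C x -> core C x.
Proof.
move=> [Cx [e e0 He]]; split=> // y Cy.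
have [t /andP[t0 t1] tD] := small_step (sqdist_ge0 y x) e0.
exists t => //; apply: He; last by rewrite sqdist_line sqrrN.
exists 2%N, (fun i => if i == 0 then x else y), (fun i => if i == 0 then 1 - - t else - t).
rewrite !big_ord_recl !big_ord0 /=; split; first by move=> i; case: ifP.
by rewrite !addr0; split=> //; ring.
Qed.

(** * Epigraphs and multipliers for the constrained convex problem *)

Lemma proper_fin k (f : 'cV[R]_k -> \bar R) x :
  proper_fun f -> (f x < +oo)%E -> exists r : R, f x = r%:E.
Proof. by move=> [/(_ x) + _]; case: (f x) => // r; exists r. Qed.

Lemma convex_fun_le k (f : 'cV[R]_k -> \bar R) x y (s u t : R) :
  convex_fun f -> 0 < t < 1 -> (f x <= s%:E)%E -> (f y <= u%:E)%E ->
  (f ((1 - t) *: x + t *: y)%R <= ((1 - t) * s + t * u)%:E)%E.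
Proof.
move=> cf t01 fx fy; apply: (le_trans (cf x y t t01)).
case/andP: t01 => t0 t1.
by rewrite [leRHS]EFinD !EFinM leeD // lee_wpmul2l // lee_fin; lra.
Qed.

(** Separates the part of the epigraph that must have a core point from the part that only has to be
    feasible. [R^o] makes the pairs a module. *)
Definition epi_system k (f : 'cV[R]_k -> \bar R) (I : finType)
    (l : I -> 'cV[R]_k * R^o -> R) (C : set ('cV[R]_k * R^o)) : Prop :=
  [/\ convex_set C, forall i, affine_fun (l i) &
    forall x (t : R), (f x <= t%:E)%E <-> C (x, t) /\ forall i, l i (x, t) <= 0].

(* A function qualified by the relative interior contributes its epigraph as the
   convex set; a polyhedral one contributes only affine inequalities. *)
Lemma qualified_epi_system k (f : 'cV[R]_k -> \bar R) x0 :
  proper_fun f -> convex_fun f ->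
  ri (edom f) x0 \/ (polyhedral_fun f /\ edom f x0) ->
  exists (I : finType) (l : I -> 'cV[R]_k * R^o -> R) (C : set ('cV[R]_k * R^o)) (s : R),
    [/\ epi_system f l C, core C (x0, s) & forall i, l i (x0, s) <= 0].
Proof.
move=> pf cf [/ri_core [dx rx]|[[p [M [a [d fE]]]] dx]];
  have [r fx] := proper_fin pf dx.
(* The height [r + 1] lies strictly above [f x0 = r]; this slack pays for the growth of [f] along
   the extension. *)
- exists 'I_0, (fun _ _ => 0), (fun z => (f z.1 <= (z.2)%:E)%E), (r + 1).
  split; [split| |by case].
  + by move=> [x s] [y u] t /= fxs fyu t01; exact: convex_fun_le.
  + by case.
  + by move=> x t; split=> [fxt|[]//]; split=> // -[].
  split=> /= [|[y u] /= fyu]; first by rewrite fx lee_fin; lra.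
  have [|e e0 dw] := rx y; first exact: le_lt_trans fyu (ltry _).
  have [v fw] := proper_fin pf dw.
  (* After a step [th * e], the convexity bound on [f] fits under the new height exactly when
     [th * q <= 1]. *)
  pose q := v - r - e * (r + 1 - u); pose th := (2 + `|q|)^-1.
  have q0 : 0 <= `|q| by [].
  have thE : th * (2 + `|q|) = 1 by rewrite /th mulVf // gt_eqF //; lra.
  have th0 : 0 < th by rewrite /th invr_gt0; lra.
  have th1 : 0 < th < 1 by rewrite th0 /=; nra.
  exists (th * e); first by rewrite mulr_gt0.
  have -> : (1 - - (th * e)) *: x0 + (- (th * e)) *: y =
      (1 - th) *: x0 + th *: ((1 - - e) *: x0 + (- e) *: y).
    by apply/colP => i; rewrite !mxE; ring.
  apply: (le_trans (convex_fun_le cf th1 (s := r) (u := v) _ _)).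
  + by rewrite fx.
  + by rewrite fw.
  rewrite lee_fin /GRing.scale /=.
  have : th * q <= th * `|q| by rewrite ler_pM2l // ler_norm.
  by rewrite /q => hq; nra.
- exists 'I_p, (fun i z => (M *m z.1) i 0 + a i 0 * z.2 - d i 0), (fun=> True), r.
  have E x t : (f x <= t%:E)%E <->
      True /\ forall i : 'I_p, (M *m x) i 0 + a i 0 * t - d i 0 <= 0.
    split=> [/fE H|[_ H]]; first by split=> // i; rewrite subr_le0.
    by apply/fE => i; rewrite -subr_le0.
  split; [split=> //| |].
  + move=> i [x s] [y u] t /=; rewrite mulmxDr -!scalemxAr !mxE /GRing.scale /=; ring.
  + by split=> // y _; exists 1.
  + by have /E[] : (f x0 <= r%:E)%E by rewrite fx.
Qed.

(** The Farkas lemma is applied to the excess [h] of the two heights over the minimal value; the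
    multipliers of [y = A x] and of the equations from [B] yield [w] and [z]. *)
Lemma constrained_min_multipliers n m r (f : 'cV[R]_n -> \bar R)
    (g : 'cV[R]_m -> \bar R) (A : 'M[R]_(m, n)) (B : 'M[R]_(r, n)) (b : 'cV[R]_r)
    (J : pred 'I_r) xs x0 :
  proper_fun f -> convex_fun f -> proper_fun g -> convex_fun g ->
  (f xs < +oo)%E -> (g (A *m xs) < +oo)%E ->
  (forall i, J i -> (B *m xs - b) i 0 = 0) ->
  (forall y, (forall i, J i -> (B *m y - b) i 0 = 0) ->
     (f xs + g (A *m xs) <= f y + g (A *m y))%E) ->
  ri (edom f) x0 \/ (polyhedral_fun f /\ edom f x0) ->
  ri (edom g) (A *m x0) \/ (polyhedral_fun g /\ edom g (A *m x0)) ->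
  (forall i, J i -> (B *m x0 - b) i 0 = 0) ->
  exists u w (z : 'cV[R]_r), [/\ subdiff f xs u, subdiff g (A *m xs) w,
    forall i, ~~ J i -> z i 0 = 0 & u + A^T *m w + B^T *m z = 0].
Proof.
move=> pf cf pg cg fs gs Js mins qf qg J0.
have [rf fE] := proper_fin pf fs; have [rg gE] := proper_fin pg gs.
have [If [lf [Cf [sf [[cCf alf Ef] corf lf0]]]]] := qualified_epi_system pf cf qf.
have [Ig [lg [Cg [sg [[cCg alg Eg] corg lg0]]]]] := qualified_epi_system pg cg qg.
pose V : lmodType R := (('cV[R]_n * R^o) * ('cV[R]_m * R^o))%type.
pose C : set V := fun z => Cf z.1 /\ Cg z.2.
pose l (i : If + Ig) (z : V) : R :=
  match i with inl i => lf i z.1 | inr i => lg i z.2 end.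
pose q (k : 'I_m + 'I_r) (z : V) : R :=
  match k with
  | inl i => (z.2.1 - A *m z.1.1) i 0
  | inr i => if J i then (B *m z.1.1 - b) i 0 else 0
  end.
pose h (z : V) : R := z.1.2 + z.2.2 - (rf + rg).
have al i : affine_fun (l i).
  by case: i => [i|i] x y t /=; [exact: alf|exact: alg].
have aq k : affine_fun (q k).
  case: k => [i|i] [[x s] [y u]] [[x' s'] [y' u']] t /=.
    by rewrite mulmxDr -!scalemxAr !mxE; ring.
  by case: (J i); rewrite ?mulmxDr -?scalemxAr ?mxE; ring.
have cC : convex_set C.
  by move=> x y t [? ?] [? ?] t01; split; [exact: cCf|exact: cCg].
have ah : affine_fun h.
  by move=> [[x s] [y u]] [[x' s'] [y' u']] t; rewrite /h /= /GRing.scale /=; ring.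
have corC : core C ((x0, sf), (A *m x0, sg)).
  split=> [|[y1 y2] [/= C1 C2]]; first by split; [case: corf|case: corg].
  have [e1 e10 D1] := corf.2 _ C1; have [e2 e20 D2] := corg.2 _ C2.
  exists (Num.min e1 e2); first by rewrite lt_min e10.
  split; [apply: convex_shrink D1 => //|apply: convex_shrink D2 => //].
  - by case: corf.
  - by rewrite lt_min e10 e20 ge_min lexx.
  - by case: corg.
  - by rewrite lt_min e10 e20 ge_min lexx orbT.
have [|||mu [tau [mu0 htau]]] := @convex_farkas_eq _ _ _ _ l q C h _ al aq cC ah corC.
- by case=> i /=; [exact: lf0|exact: lg0].
- by case=> i /=; [rewrite subrr mxE|case: ifP => // /J0].
- move=> [[x s] [y u]] [/= Cx Cy] lx qx; rewrite /h /=.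
  have yE : y = A *m x.
    apply/colP => i; have := qx (inl i); rewrite /= !mxE => /eqP.
    by rewrite subr_eq0 => /eqP.
  have fx : (f x <= s%:E)%E.
    by apply/Ef; split=> // i; have := lx (inl i).
  have gx : (g (A *m x) <= u%:E)%E.
    by rewrite -yE; apply/Eg; split=> // i; have := lx (inr i).
  have /le_trans/(_ (leeD fx gx)) : (f xs + g (A *m xs) <= f x + g (A *m x))%E.
    by apply: mins => i Ji; have := qx (inr i); rewrite /= Ji.
  by rewrite fE gE -!EFinD lee_fin subr_ge0.
pose w : 'cV[R]_m := \col_i - tau (inl i).
pose z : 'cV[R]_r := \col_i (if J i then tau (inr i) else 0).
(* The Lagrangian inequality: the inequality multipliers contribute nonpositive terms on the
   epigraphs and drop out. *)
have key x s y u : (f x <= s%:E)%E -> (g y <= u%:E)%E ->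
    rf + rg <= s + u - dotv w (y - A *m x) + dotv z (B *m x - b).
  move=> /Ef [Cx lx] /Eg [Cy ly].
  have := htau ((x, s), (y, u)) (conj Cx Cy).
  rewrite /h /= !big_sumType /=.
  have sf0 : \sum_i mu (inl i) * lf i (x, s) <= 0.
    by apply: sumr_le0 => i _; rewrite mulr_ge0_le0.
  have sg0 : \sum_i mu (inr i) * lg i (y, u) <= 0.
    by apply: sumr_le0 => i _; rewrite mulr_ge0_le0.
  have -> : \sum_i tau (inl i) * (y - A *m x) i 0 = - dotv w (y - A *m x).
    by rewrite /dotv -sumrN; apply: eq_bigr => i _; rewrite [w _ _]mxE mulNr opprK.
  have -> : \sum_i tau (inr i) * (if J i then (B *m x - b) i 0 else 0) =
      dotv z (B *m x - b).
    apply: eq_bigr => i _; rewrite [z _ _]mxE.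
    by case: (J i); rewrite ?mulr0 ?mul0r.
  by lra.
have zs0 : dotv z (B *m xs - b) = 0.
  rewrite /dotv big1 // => i _; rewrite [z _ _]mxE.
  by case: ifP => [/Js ->|_]; rewrite ?mulr0 ?mul0r.
exists (- (A^T *m w + B^T *m z)), w, z; split.
- split=> [|x]; first by rewrite fE.
  have [fx|fx] := ltP (f x) +oo%E; last exact: le_trans (leey _) fx.
  have [s fxE] := proper_fin pf fx.
  (* Fixing [y = A xs] isolates [f]; below, fixing [x = xs] isolates [g]. *)
  have := key x s (A *m xs) rg; rewrite fxE gE !lexx => /(_ isT isT).
  rewrite fE -EFinD lee_fin dotvNl dotvDl !dotv_trmx.
  move: zs0; rewrite !mulmxBr !dotvBr.
  by lra.
- split=> [|y]; first by rewrite gE.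
  have [gy|gy] := ltP (g y) +oo%E; last exact: le_trans (leey _) gy.
  have [u gyE] := proper_fin pg gy.
  have := key xs rf y u; rewrite fE gyE !lexx => /(_ isT isT).
  by rewrite gE -EFinD lee_fin zs0; lra.
- by move=> i /negPf Ji; rewrite mxE Ji.
- by rewrite -addrA addNr.
Qed.

(** * Local behaviour of [Phi0] *)

Lemma sqdist_mulmx_small n r (B : 'M[R]_(r, n)) (x : 'cV[R]_n) i (d : R) : 0 < d ->
  exists2 e, 0 < e & forall y, sqdist y x < e -> `|(B *m (y - x)) i 0| < d.
Proof.
move=> d0; pose c := 1 + \sum_j `|B i j|.
have s0 : 0 <= \sum_j `|B i j| by exact: sumr_ge0.
have c0 : 0 < c by rewrite /c; lra.
have dc0 : 0 < d / c by rewrite divr_gt0.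
exists ((d / c) ^+ 2) => [|y yx]; first by rewrite exprn_gt0.
have yj j : `|y j 0 - x j 0| <= d / c.
  rewrite -(@ler_pXn2r _ 2) // ?nnegrE // ?(ltW dc0) //.
  rewrite -normrX ger0_norm ?sqr_ge0 //; apply: le_trans (ltW yx).
  rewrite /sqdist (bigD1 j) //= lerDl; apply: sumr_ge0 => k _; exact: sqr_ge0.
rewrite mxE; apply: le_lt_trans (ler_norm_sum _ _ _) _.
apply: (@le_lt_trans _ _ ((\sum_j `|B i j|) * (d / c))).
  rewrite mulr_suml; apply: ler_sum => j _; rewrite normrM.
  by apply: ler_wpM2l => //; rewrite !mxE.
have dcE : d / c * c = d by rewrite mulfVK // gt_eqF.
by move: dcE; rewrite {2}/c; nra.
Qed.

Lemma finite_radius (I : finType) (P : I -> R -> Prop) :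
  (forall i e e', 0 < e' <= e -> P i e -> P i e') ->
  (forall i, exists2 e, 0 < e & P i e) -> exists2 e, 0 < e & forall i, P i e.
Proof.
move=> mono ex; pose e i := sval (cid2 (ex i)).
have e0 i : 0 < e i by rewrite /e; case: cid2.
have Pe i : P i (e i) by rewrite /e; case: cid2.
(* The default 1 keeps the minimum positive when [I] is empty. *)
pose e1 := \big[Num.min/1]_i e i.
have e10 : 0 < e1 by apply: lt_bigmin => // i _; exact: e0.
exists e1 => // i; apply: (mono i (e i)) => //.
by rewrite e10 /e1 bigmin_le_cond.
Qed.

(** This subgradient inequality holds locally without a remainder, so it can be added to the global
    ones for [f] and [g]. *)
Lemma Phi0_subdiff_local n r (B : 'M[R]_(r, n)) (b lam z : 'cV[R]_r) x :
  (forall i, 0 < lam i 0) -> subdiff_Phi0 (B *m x - b) z ->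
  exists2 e, 0 < e & forall y, sqdist y x < e ->
    Phi0 lam (B *m x - b) + dotv z (B *m (y - x)) <= Phi0 lam (B *m y - b).
Proof.
move=> lam0 zx.
have [||e e0 He] := @finite_radius _ (fun i e => forall y, sqdist y x < e ->
  lam i 0 * ((B *m x - b) i 0 != 0)%:R + z i 0 * (B *m (y - x)) i 0
    <= lam i 0 * ((B *m y - b) i 0 != 0)%:R).
- by move=> i e e' /andP[_ ee'] H y yx; apply: H; exact: lt_le_trans ee'.
- move=> i; have shift y : (B *m y - b) i 0 = (B *m x - b) i 0 + (B *m (y - x)) i 0.
    by rewrite mulmxBr !mxE; ring.
  have [ux|ux] := eqVneq ((B *m x - b) i 0) 0.
    (* With this bound the linear term stays below the jump [lam i 0]. *)
    have [e e0 He] := sqdist_mulmx_small B x i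
      (d := lam i 0 / (1 + `|z i 0|)) (divr_gt0 (lam0 i) (ltr_wpDr (normr_ge0 _) ltr01)).
    exists e => // y /He; rewrite shift ux add0r mulr0 add0r.
    have [->|vy] := eqVneq; first by rewrite !mulr0.
    rewrite mulr1 ltr_pdivlMr ?ltr_wpDr // => H.
    apply: le_trans (ler_norm _) _; rewrite normrM.
    by have := normr_ge0 ((B *m (y - x)) i 0); have := normr_ge0 (z i 0); nra.
  (* A change smaller than the component itself cannot cancel it. *)
  have [e e0 He] := sqdist_mulmx_small B x i (d := `|(B *m x - b) i 0|)
    ltac:(by rewrite normr_gt0).
  exists e => // y /He vy; rewrite (zx i ux) mul0r addr0 shift.
  suff -> : (B *m x - b) i 0 + (B *m (y - x)) i 0 != 0 by [].
  by apply: contraTneq vy => /eqP; rewrite addr_eq0 => /eqP ->; rewrite normrN ltxx.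
exists e => // y yx; rewrite /Phi0 /dotv -big_split /=.
by apply: ler_sum => i _; exact: He.
Qed.

(** * Stationary points and local minimizers *)

Lemma stationary_local_min n m r (f : 'cV[R]_n -> \bar R) (g : 'cV[R]_m -> \bar R)
    (A : 'M[R]_(m, n)) (B : 'M[R]_(r, n)) (b lam : 'cV[R]_r) x :
  proper_fun f -> proper_fun g -> (forall i, 0 < lam i 0) ->
  stationary f g A B b x -> local_min (Fobj f g A B b lam) x.
Proof.
move=> pf pg lam0 [u [w [z [[ffin Hu] [[gfin Hw] [zx uwz]]]]]].
have [e e0 He] := Phi0_subdiff_local lam0 zx.
exists e => // y /He HPhi; rewrite /Fobj.
have [fy|fy] := ltP (f y) +oo%E; last first.
  move: fy; rewrite leye_eq => /eqP ->.
  by case: (g (A *m y)) (pg.1 (A *m y)) => //= *; rewrite leey.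
have [gy|gy] := ltP (g (A *m y)) +oo%E; last first.
  move: gy; rewrite leye_eq => /eqP ->.
  by case: (f y) (pf.1 y) => //= *; rewrite leey.
have [s fyE] := proper_fin pf fy; have [t gyE] := proper_fin pg gy.
have := Hu y; have := Hw (A *m y).
rewrite fyE gyE -(fineK ffin) -(fineK gfin) -!EFinD !lee_fin => Hg Hf.
(* Pairing stationarity with [y - x] cancels the linear terms of the three subgradient
   inequalities. *)
have := congr1 (fun v => dotv v (y - x)) uwz.
rewrite !dotvDl !dotv_trmx [dotv 0 _]big1; last by move=> i _; rewrite mxE mul0r.
move: Hg; rewrite -mulmxBr => Hg H.
by lra.
Qed.

Lemma local_min_stationary n m r (f : 'cV[R]_n -> \bar R) (g : 'cV[R]_m -> \bar R)
    (A : 'M[R]_(m, n)) (B : 'M[R]_(r, n)) (b lam : 'cV[R]_r) x :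
  proper_fun f -> convex_fun f -> proper_fun g -> convex_fun g ->
  (forall i, 0 < lam i 0) -> local_min (Fobj f g A B b lam) x ->
  (Fobj f g A B b lam x < +oo)%E -> slater f g A B b x -> stationary f g A B b x.
Proof.
move=> pf cf pg cg lam0 [e e0 xmin] Fx [x0 [qf [qg Hx0]]].
have [fx gx] : (f x < +oo)%E /\ (g (A *m x) < +oo)%E.
  move: Fx (pf.1 x) (pg.1 (A *m x)); rewrite /Fobj.
  by case: (f x) => [?||]; case: (g (A *m x)) => [?||] //= *; rewrite !ltry.
have [rf fE] := proper_fin pf fx; have [rg gE] := proper_fin pg gx.
have [||i|u [w [z [Hu Hw Hz uwz]]]] := @constrained_min_multipliers _ _ _ f g A B b
  (fun i => (B *m x - b) i 0 == 0) x x0 pf cf pg cg fx gx _ _ qf qg.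
- by move=> i /eqP.
- move=> y Hy.
  have [fy|fy] := ltP (f y) +oo%E; last first.
    move: fy; rewrite leye_eq => /eqP ->.
    by case: (g (A *m y)) (pg.1 (A *m y)) => //= *; rewrite leey.
  have [gy|gy] := ltP (g (A *m y)) +oo%E; last first.
    move: gy; rewrite leye_eq => /eqP ->.
    by case: (f y) (pf.1 y) => //= *; rewrite leey.
  have [s fyE] := proper_fin pf fy; have [t gyE] := proper_fin pg gy.
  (* A short step towards [y] stays in the ball of local minimality; convexity then transfers the
     comparison from [v] to [y]. *)
  have [th th01 Hth] := small_step (sqdist_ge0 y x) e0.
  pose v := (1 - th) *: x + th *: y.
  have fv : (f v <= ((1 - th) * rf + th * s)%:E)%E.
    by apply: convex_fun_le => //; rewrite ?fE ?fyE.
  have gv : (g (A *m v) <= ((1 - th) * rg + th * t)%:E)%E.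
    by rewrite /v mulmxDr -!scalemxAr; apply: convex_fun_le => //; rewrite ?gE ?gyE.
  (* Components zero at [x] are zero at [y], hence at [v]; the others already pay their full weight
     at [x]. *)
  have Phiv : Phi0 lam (B *m v - b) <= Phi0 lam (B *m x - b).
    apply: ler_sum => i _; apply: ler_wpM2l; first exact: ltW.
    have [ux|ux] := eqVneq ((B *m x - b) i 0) 0; last by case: (_ != _).
    have -> : (B *m v - b) i 0 = 0; last by rewrite eqxx.
    have := Hy i; rewrite ux eqxx => /(_ isT) uy.
    have -> : B *m v - b = (1 - th) *: (B *m x - b) + th *: (B *m y - b).
      by rewrite /v mulmxDr -!scalemxAr; apply/colP => j; rewrite !mxE; ring.
    by rewrite mxE [X in X + _]mxE [X in _ + X]mxE ux uy !mulr0 addr0.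
  have Fv : (Fobj f g A B b lam x <= Fobj f g A B b lam v)%E.
    by apply: xmin; rewrite sqdist_line.
  have PhivE : ((Phi0 lam (B *m v - b))%:E <= (Phi0 lam (B *m x - b))%:E)%E.
    by rewrite lee_fin.
  move: (le_trans Fv (leeD (leeD fv gv) PhivE)).
  rewrite /Fobj fE gE fyE gyE -!EFinD !lee_fin lerD2r => H.
  by case/andP: th01 => th0 th1; nra.
- by move=> /eqP; exact: Hx0.
- by exists u, w, z.
Qed.

End ConvexAnalysis.

Unset Implicit Arguments.
Set Strict Implicit.

Theorem mainTheorem12 (R : realType) (n m r : nat)
  (f : 'cV[R]_n -> \bar R) (g : 'cV[R]_m -> \bar R)
  (A : 'M[R]_(m, n)) (B : 'M[R]_(r, n)) (b lam : 'cV[R]_r) :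
  proper_fun f -> lsc_fun f -> convex_fun f ->
  proper_fun g -> lsc_fun g -> convex_fun g ->
  (forall i, 0 < lam i 0) ->
  (forall x, stationary f g A B b x -> local_min (Fobj f g A B b lam) x) /\
  (forall x, local_min (Fobj f g A B b lam) x ->
     (Fobj f g A B b lam x < +oo)%E ->
     slater f g A B b x -> stationary f g A B b x).
Proof.
move=> pf _ cf pg _ cg lam0; split=> x; first exact: stationary_local_min.
exact: local_min_stationary.
Qed.
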